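(* Let $n\ge 3$, $p\in\{2,\dots,n-1\}$, and let $g$ be a complex polynomial with $g(0)\neq 0$ and $\deg(g)<n-p$. Let $J_n$ be the nilpotent Jordan block of size $n$, and let $k$ be the coefficient of degree two of the polynomial $X^pg(X)$. All nilpotent solutions $X=[x_{ij}]\in\mathcal{M}_n(\mathbb{C})$ of $$XJ_n-J_nX=X^pg(X)$$ are obtained as follows. Every nilpotent solution is strictly upper triangular and satisfies $$\text{for all } i\in\{1,\dots,n-2\},\quad 1-i\,k\,x_{n-1,n}\neq 0.\qquad ( * )$$ Conversely, for every choice of complex numbers $x_{1,n},\dots,x_{n-1,n}$ such that $( * )$ holds, there is exactly one nilpotent solution $X$ whose last column is $(x_{1,n},\dots,x_{n-1,n},0)^T$; its other strictly upper triangular entries are obtained recursively, each as the solution of an equation of degree one whose coefficients depend on entries already obtained.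
   Context: $J_n$ is the $n\times n$ matrix with entries $1$ on the first superdiagonal and $0$ elsewhere. *)

(* Defs.v *)
From HB Require Import structures.
From mathcomp Require Import all_boot all_order all_algebra.
From mathcomp Require Import reals.
From mathcomp.real_closed Require Export complex.

Set Implicit Arguments.
Unset Strict Implicit.
Unset Printing Implicit Defensive.

Import GRing.Theory.
Local Open Scope ring_scope.

(* The matrix size is n = n'.+1, as required by [horner_mx].  Indices are
   0-based, so the mathematical entry x_{i,j} is [X] at row i-1, column j-1;
   in particular index n is [ord_max], of value n', and index n-1 is
   [inord n'.-1]. *)

Section MatrixEquation.
Variables (F : fieldType) (n' : nat).
Local Notation n := n'.+1.
Local Notation position := ('I_n * 'I_n)%type.
Implicit Types (X Y : 'M[F]_n) (g : {poly F}) (p : nat).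

Definition nilJordan : 'M[F]_n := \matrix_(i, j) (i.+1 == j)%:R.

Definition nilpotent_mx X : Prop := exists m : nat, X ^+ m = 0.

Definition strictly_upper X : Prop := forall i j : 'I_n, (j <= i)%N -> X i j = 0.

Definition eq_lhs X : 'M[F]_n := X *m nilJordan - nilJordan *m X.

Definition eq_rhs p g X : 'M[F]_n := X ^+ p *m horner_mx X g.

Definition nilpotent_solution p g X : Prop :=
  nilpotent_mx X /\ eq_lhs X = eq_rhs p g X.

Definition coef2 p g : F := ('X^p * g)`_2.

(* The condition 1 - i k t <> 0 for 1 <= i <= n-2, to be used at t = x_{n-1,n}. *)
Definition admissible p g (t : F) : Prop :=
  forall i : nat, (1 <= i <= n - 2)%N -> 1 - i%:R * coef2 p g * t != 0.

(* When the entries are computed in the order of the list [s], this says that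
   the entry at [u] is available when the one at [t] is to be computed. The last
   column is available from the start. *)
Definition obtained (s : seq position) (t u : position) : bool :=
  (u.2 == ord_max) || (u \in take (index t s) s).

(* The strictly upper triangular positions outside the last column can be listed
   in an order [s] such that, for each t in [s], the scalar equation at some
   entry [e t] of the matrix equation reads  a t X * x_t = b t X  on strictly
   upper triangular matrices, where a t X and b t X depend only on the last
   column of X and on its entries at positions listed before t, and where
   a t X <> 0 as soon as X is admissible and the equations listed before t
   hold.
   Since [a] and [b] do not depend on x_t, the identity with the scalar equation
   determines them once s and e are chosen; they cannot encode a solution
   known beforehand. *)
Definition recursively_solvable p g : Prop :=
  exists (s : seq position) (e : position -> position)
         (a b : position -> 'M[F]_n -> F),
  [/\ uniq s,
      forall t : position, (t \in s) = (t.1 < t.2 < n')%N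
    & forall t : position, t \in s ->
      [/\ forall X Y, strictly_upper X -> strictly_upper Y ->
            (forall u, obtained s t u -> X u.1 u.2 = Y u.1 u.2) ->
            a t X = a t Y /\ b t X = b t Y,
          forall X, strictly_upper X ->
            (eq_lhs X - eq_rhs p g X) (e t).1 (e t).2
              = a t X * X t.1 t.2 - b t X
        & forall X, strictly_upper X ->
            admissible p g (X (inord n'.-1) ord_max) ->
            (forall u, u \in take (index t s) s ->
               a u X * X u.1 u.2 = b u X) ->
            a t X != 0]].

End MatrixEquation.

(* Main.v *)
Require Import Defs.
From HB Require Import structures.
From mathcomp Require Import all_boot all_order all_algebra.
From mathcomp Require Import reals.
From mathcomp.real_closed Require Import complex.
From mathcomp Require Import zify ring.

Import GRing.Theory.
Local Open Scope ring_scope.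

(** Write [J] for the nilpotent Jordan block and [X^p g(X) = T X^2], where [T]
is a polynomial in [X]; this is possible because [p >= 2].

A nilpotent solution is strictly upper triangular.  From [X J = J X + T X^2]
one gets [X^m J = (J + m T X) X^m] ([commute_expX]), so the kernel of every
[X^m] is stable under [J].  The [J]-stable subspaces are exactly the spans of the
first basis vectors ([ker_uniserial]), and [X] maps the kernel of [X^m] into
that of [X^(m-1)]; this forces [X e_j] to lie in the span of the [e_i] with
[i < j].

On strictly upper triangular matrices the equation is a triangular system.
Its entry at [(i, j+1)] reads
  [x_(i,j) (1 - k x_(j,j+1)) = x_(i+1,j+1) + terms on shorter diagonals
     + k times products x_(i,c) x_(c,j+1) with c <> j],
because a power [X^l] with [l >= 3] only sees, at distance [j+1-i] from the
diagonal, entries of [X] at distance less than [j-i] ([eq_higher_terms]).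
Solving diagonal by diagonal, and on each diagonal from the bottom up, gives
the recursion ([eqn_affine], [pivot_local]); the entries of the equation on
and below the first superdiagonal hold trivially ([eqn_below_band]).

The pivots are controlled by the first superdiagonal.  With
[y_m = x_(n-1-m,n-m)] the recursion there is [y_(m+1) (1 - k y_m) = y_m],
whose solution is [y_m = y_0 / (1 - m k y_0)] ([fractional_chain]).  Hence the
denominators [1 - m k y_0] cannot vanish on a solution, and conversely, when
none of them vanishes, every pivot
[1 - k y_m = (1 - (m+1) k y_0) / (1 - m k y_0)] is nonzero ([pivot_neq0]). *)
Section NilpotentSolutions.

Set Implicit Arguments.
Unset Strict Implicit.

Variables (F : fieldType) (n' : nat).
Local Notation n := n'.+1.
Local Notation position := ('I_n * 'I_n)%type.
Local Notation J := (nilJordan F n').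
Implicit Types (X Y T : 'M[F]_n) (p : nat) (g : {poly F}).

(** * The matrix equation entry by entry *)

Lemma mul_nilJordanl m (Y : 'M[F]_(n, m)) i j :
  (J *m Y) i j = if (i < n')%N then Y (inord i.+1) j else 0.
Proof.
rewrite mxE; case: ifP => [lt_in|/negbT]; last first.
  rewrite -leqNgt => le_ni; apply: big1 => k _; rewrite mxE.
  by case: eqP => [ik|_]; rewrite ?mul0r //; have := ltn_ord k; lia.
rewrite (bigD1 (inord i.+1)) //= mxE inordK // eqxx mul1r big1 ?addr0 // => k nk.
rewrite mxE; case: eqP => [ik|_]; rewrite ?mul0r //.
by rewrite ik inord_val eqxx in nk.
Qed.

Lemma mul_nilJordanr X i j :
  (X *m J) i j = if (0 < j)%N then X i (inord j.-1) else 0.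
Proof.
rewrite mxE; case: ifP => [j_gt0|/negbT]; last first.
  by rewrite -eqn0Ngt => /eqP j0; apply: big1 => k _; rewrite mxE j0 mulr0.
have lt_j := ltn_ord j.
rewrite (bigD1 (inord j.-1)) //= mxE inordK; last by lia.
rewrite prednK // eqxx mulr1 big1 ?addr0 // => k nk.
rewrite mxE; case: eqP => [kj|_]; rewrite ?mulr0 //.
by rewrite -kj inord_val eqxx in nk.
Qed.

Lemma eq_rhsE p g X : eq_rhs p g X = horner_mx X ('X^p * g).
Proof. by rewrite /eq_rhs rmorphM rmorphXn /= horner_mx_X. Qed.

Lemma horner_mx_sum X (q : {poly F}) m : (size q <= m)%N ->
  horner_mx X q = \sum_(l < m) q`_l *: X ^+ l.
Proof.
move=> le_qm; have {1}-> : q = \sum_(l < m) q`_l *: 'X^l.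
  rewrite -poly_def; apply/polyP=> l; rewrite coef_poly.
  by case: ltnP => // le_ml; rewrite nth_default // (leq_trans le_qm).
by rewrite linear_sum; apply: eq_bigr => l _; rewrite linearZ /= rmorphXn /= horner_mx_X.
Qed.

(** The terms of degree at least three of [eq_rhs p g X]. *)
Definition higher_terms p g X : 'M[F]_n :=
  \sum_(l < size ('X^p * g)) ('X^p * g)`_l.+3 *: X ^+ l.+3.

Lemma eq_rhs_split p g X : (2 <= p)%N ->
  eq_rhs p g X = coef2 p g *: X ^+ 2 + higher_terms p g X.
Proof.
move=> p_ge2; rewrite eq_rhsE (@horner_mx_sum _ _ (size ('X^p * g)).+3); last by lia.
rewrite 3!big_ord_recl /= !coefXnM.
have -> : (0 < p)%N by lia.
have -> : (1 < p)%N by lia.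
by rewrite !scale0r !add0r /coef2 coefXnM.
Qed.

Lemma eq_rhs_sqr p g X : (2 <= p)%N ->
  exists2 T, eq_rhs p g X = T * X ^+ 2 & X * T = T * X.
Proof.
move=> p_ge2; exists (horner_mx X ('X^(p - 2) * g)).
  rewrite eq_rhsE -{1}(subnK p_ge2) exprD mulrAC rmorphM rmorphXn /=.
  by rewrite horner_mx_X.
have := congr1 (horner_mx X) (mulrC 'X ('X^(p - 2) * g)).
by rewrite !rmorphM /= horner_mx_X.
Qed.

(** * Nilpotent solutions are strictly upper triangular *)

(** The derivation [X |-> X J - J X] sends [X ^+ m] to [m] times
    [T * X ^+ m.+1]; the shape below exhibits the kernel of [X ^+ m] as stable
    under [J]. *)
Lemma commute_expX X T m : X * J = J * X + T * X ^+ 2 -> X * T = T * X ->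
  X ^+ m * J = (J + (T * X) *+ m) * X ^+ m.
Proof.
move=> XJ XT; elim: m => [|m IHm]; first by rewrite !expr0 mulr0n addr0 mulr1 mul1r.
rewrite exprS -mulrA IHm !mulrA; congr (_ * _).
rewrite mulrDr XJ mulrnAr mulrA XT mulrDl mulrnAl expr2 mulrA.
by rewrite -addrA -mulrS.
Qed.

(** A [J]-stable kernel that contains a vector [w] whose last nonzero entry is
    at [t] contains the basis vectors [e_j] for all [j <= t]. *)
Lemma ker_uniserial (M : 'M[F]_n) :
    (forall w : 'cV_n, M *m w = 0 -> M *m (J *m w) = 0) ->
  forall (t : 'I_n) (w : 'cV[F]_n), M *m w = 0 -> w t 0 != 0 ->
    (forall i : 'I_n, (t < i)%N -> w i 0 = 0) ->
  forall j : 'I_n, (j <= t)%N -> col j M = 0.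
Proof.
move=> kerJ [t lt_tn]; elim: t lt_tn => [|t IHt] lt_tn w Mw0 wt wgt.
  (* Once the columns of M before t vanish, M w = 0 reduces to w_t times
     column t. *)
  all: have colt : (forall j : 'I_n, (j < Ordinal lt_tn)%N -> col j M = 0) ->
                   col (Ordinal lt_tn) M = 0.
  1,3: move=> col_lt; apply/matrixP=> i z; move/matrixP/(_ i z): Mw0.
  1,2: rewrite (ord1 z) !mxE (bigD1 (Ordinal lt_tn)) //= big1 ?addr0.
  1,3: by move=> /eqP; rewrite mulf_eq0 (negPf wt) orbF => /eqP.
  1,2: move=> k; rewrite neq_ltn => /orP[lt_k|gt_k]; last by rewrite wgt ?mulr0.
  1,2: by move/matrixP/(_ i 0): (col_lt _ lt_k); rewrite !mxE => ->; rewrite mul0r.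
- move=> j le_j0; have -> : j = Ordinal lt_tn by apply: val_inj => /=; move: le_j0 => /=; lia.
  by apply: colt => k; rewrite ltn0.
have lt_tn' : (t < n)%N by lia.
have col_lt : forall j : 'I_n, (j <= t)%N -> col j M = 0.
  apply: (IHt lt_tn' (J *m w)); first exact: kerJ.
    rewrite mul_nilJordanl /=; have -> : (t < n')%N by lia.
    by rewrite (_ : inord t.+1 = Ordinal lt_tn) //; apply: val_inj; rewrite /= inordK.
  move=> i /= lt_ti; rewrite mul_nilJordanl; case: ifP => // lt_in.
  by apply: wgt; rewrite inordK.
move=> j; rewrite leq_eqVlt => /orP[/eqP jt|]; last exact: col_lt.
by rewrite (val_inj jt : j = Ordinal lt_tn); apply: colt => k; exact: col_lt.
Qed.

Lemma nilpotent_solution_upper p g X : (2 <= p)%N ->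
  nilpotent_solution p g X -> strictly_upper X.
Proof.
move=> p_ge2 [[m0 Xm0] eqX] i j le_ji; apply/eqP/negP => /negP Xij.
have [T rhsE XT] := eq_rhs_sqr g X p_ge2.
have XJ : X * J = J * X + T * X ^+ 2.
  by rewrite -rhsE -eqX /eq_lhs addrC -!mulmxE subrK.
(* Let m be least with X^m e_j = 0, and t the last nonzero entry of X e_j.
   If t >= j, the kernel of X^(m-1) contains X e_j, hence also e_j. *)
have [m /eqP Xm0j min_m] : {m | col j (X ^+ m) == 0 & forall l, col j (X ^+ l) == 0 -> (m <= l)%N}.
  have ex_m : exists m, col j (X ^+ m) == 0 by exists m0; rewrite Xm0 col0.
  by case: (ex_minnP ex_m) => m ? ?; exists m.
case: m Xm0j min_m => [|m] Xm0j min_m.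
  by move/matrixP/(_ j 0): Xm0j; rewrite expr0 !mxE eqxx => /eqP; rewrite oner_eq0.
case: (@arg_maxnP _ i (fun t => X t j != 0) (fun t : 'I_n => val t) Xij).
move=> t Xtj max_t.
suff /eqP : col j (X ^+ m) = 0 by move/min_m; rewrite ltnn.
apply: (@ker_uniserial (X ^+ m) _ t (col j X)); rewrite ?mxE //.
- move=> w Xw0; rewrite mulmxA (commute_expX m XJ XT : X ^+ m *m J = _).
  by rewrite -mulmxE -mulmxA Xw0 mulmx0.
- by rewrite -Xm0j exprSr -mulmxE !colE mulmxA.
- move=> k lt_tk; rewrite mxE; apply/eqP/negPn/negP => /max_t /=.
  by rewrite leqNgt lt_tk.
- exact: leq_trans le_ji (max_t _ Xij).
Qed.

(** * Powers of strictly upper triangular matrices *)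

Lemma expX_band X l (i j : 'I_n) : strictly_upper X ->
  (j < i + l)%N -> (X ^+ l) i j = 0.
Proof.
move=> upX; elim: l i j => [|l IHl] i j lt_j.
  rewrite expr0 mxE; case: eqP => // ij; move: lt_j; rewrite ij; lia.
rewrite exprS -mulmxE mxE big1 // => k _.
have [le_ki|lt_ik] := leqP k i; first by rewrite upX ?mul0r.
by rewrite IHl ?mulr0 //; lia.
Qed.

Lemma strictly_upper_nilpotent X : strictly_upper X -> nilpotent_mx X.
Proof.
move=> upX; exists n; apply/matrixP=> i j; rewrite expX_band ?mxE //.
by have := ltn_ord j; lia.
Qed.

(** A product of [l.+1] strictly upper triangular factors that reaches the
    position [(i, j)] uses only entries at distance at most [j - i - l] from
    the diagonal. *)
Lemma eq_expX_band X Y d l : strictly_upper X -> strictly_upper Y ->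
    (forall i j : 'I_n, (j < i + d)%N -> X i j = Y i j) ->
  forall i j : 'I_n, (j < i + d + l)%N -> (X ^+ l.+1) i j = (Y ^+ l.+1) i j.
Proof.
move=> upX upY eqXY; elim: l => [|l IHl] i j lt_j.
  by rewrite !expr1 eqXY //; lia.
rewrite exprS (exprS Y) -!mulmxE !mxE; apply: eq_bigr => k _.
have [le_ki|lt_ik] := leqP k i; first by rewrite upX ?upY ?mul0r ?mul0r.
have [lt_jk|le_kj] := ltnP j (k + l.+1).
  by rewrite !(@expX_band _ l.+1) ?mulr0.
by rewrite eqXY ?IHl //; lia.
Qed.

Lemma eq_higher_terms p g X Y d : strictly_upper X -> strictly_upper Y ->
    (forall i j : 'I_n, (j < i + d)%N -> X i j = Y i j) ->
  forall i j : 'I_n, (j <= i + d.+1)%N ->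
    higher_terms p g X i j = higher_terms p g Y i j.
Proof.
move=> upX upY eqXY i j le_j; rewrite !summxE; apply: eq_bigr => l _.
rewrite [LHS]mxE [RHS]mxE; congr (_ * _).
by apply: (@eq_expX_band X Y d l.+2) => //; lia.
Qed.

(** * The scalar equations *)

Lemma eqn_entry p g X i j : (2 <= p)%N ->
  (eq_lhs X - eq_rhs p g X) i j = (X *m J) i j - (J *m X) i j
    - (coef2 p g * (X ^+ 2) i j + higher_terms p g X i j).
Proof.
move=> p_ge2; rewrite eq_rhs_split // /eq_lhs.
have addE (A B : 'M[F]_n) : (A + B) i j = A i j + B i j by rewrite mxE.
have oppE (A : 'M[F]_n) : (- A) i j = - A i j by rewrite mxE.
by rewrite addE oppE !addE oppE; congr (_ - (_ + _)); rewrite mxE.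
Qed.

(** On a strictly upper triangular matrix the equation is trivially satisfied
    on and below the first superdiagonal. *)
Lemma eqn_below_band p g X (i j : 'I_n) : (2 <= p)%N -> strictly_upper X ->
  (j <= i.+1)%N -> (eq_lhs X - eq_rhs p g X) i j = 0.
Proof.
move=> p_ge2 upX le_j; rewrite eqn_entry // expX_band //; last by lia.
have -> : (X *m J) i j = 0.
  rewrite mul_nilJordanr; case: ifP => // j_gt0; have lt_jn := ltn_ord j.
  by rewrite upX // inordK; lia.
have -> : (J *m X) i j = 0.
  by rewrite mul_nilJordanl; case: ifP => // lt_in; rewrite upX // inordK.
rewrite summxE big1 ?mulr0 ?addr0 ?subr0 // => l _.
by rewrite mxE expX_band ?mulr0 //; lia.
Qed.

(** The entry of the matrix equation from which the entry of [X] at [t] is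
    computed: the next one on the same row. *)
Definition eqn_pos (t : position) : position := (t.1, inord t.2.+1).

(** The coefficient of the unknown at [t] in the scalar equation at
    [eqn_pos t]. *)
Definition pivot p g (t : position) X : F :=
  1 - coef2 p g * X t.2 (inord t.2.+1).

(** The right-hand side of that scalar equation.  The quadratic part of
    [eq_rhs p g X] leaves out the index [c = t.2], whose term is the product of
    the unknown with [X t.2 (inord t.2.+1)] and belongs to [pivot]. *)
Definition pivot_rhs p g (t : position) X : F :=
  X (inord t.1.+1) (inord t.2.+1)
  + coef2 p g * (\sum_(c | c != t.2) X t.1 c * X c (inord t.2.+1))
  + higher_terms p g X t.1 (inord t.2.+1).

Lemma eqn_affine p g (t : position) X : (2 <= p)%N -> (t.1 < t.2 < n')%N ->
  (eq_lhs X - eq_rhs p g X) (eqn_pos t).1 (eqn_pos t).2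
    = pivot p g t X * X t.1 t.2 - pivot_rhs p g t X.
Proof.
case: t => i j /= p_ge2 /andP[lt_ij lt_jn]; rewrite eqn_entry //.
rewrite /pivot /pivot_rhs /= mul_nilJordanr mul_nilJordanl.
rewrite inordK // inord_val (ltn_trans lt_ij lt_jn) /=.
by rewrite expr2 mxE (bigD1 j) //=; ring.
Qed.

(** * Triangular systems of scalar equations *)

(** A system of equations [a t X * x_t = b t X] over strictly upper triangular
    matrices with prescribed last column has a solution as soon as [a] and [b]
    only involve entries already obtained and the equations solved before [t]
    make [a t X] nonzero. *)
Lemma triangular_system_exists (s : seq position)
    (a b : position -> 'M[F]_n -> F) (v : 'cV[F]_n) :
    uniq s -> (forall t, t \in s -> (t.1 < t.2 < n')%N) ->
    (forall t, t \in s -> forall X Y, strictly_upper X -> strictly_upper Y ->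
       (forall u, obtained s t u -> X u.1 u.2 = Y u.1 u.2) ->
       a t X = a t Y /\ b t X = b t Y) ->
    (forall t, t \in s -> forall X, strictly_upper X -> col ord_max X = v ->
       (forall u, u \in take (index t s) s -> a u X * X u.1 u.2 = b u X) ->
       a t X != 0) ->
    v ord_max 0 = 0 ->
  exists X, [/\ strictly_upper X, col ord_max X = v
             & forall t, t \in s -> a t X * X t.1 t.2 = b t X].
Proof.
move=> uniq_s range_s local_ab a_neq0 v_max.
suff solve m : (m <= size s)%N -> exists X, [/\ strictly_upper X, col ord_max X = v
             & forall t, t \in take m s -> a t X * X t.1 t.2 = b t X].
  by have := solve _ (leqnn _); rewrite take_size.
elim: m => [_|m IHm lt_ms].
  exists (\matrix_(i, j) if j == ord_max then v i 0 else 0); split=> //.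
  - move=> i j le_ji; rewrite mxE; case: eqP => // jmax; rewrite -[RHS]v_max.
    congr (v _ _); apply: val_inj; rewrite /=; move: le_ji (ltn_ord i).
    by rewrite jmax /=; lia.
  - by apply/matrixP=> i j; rewrite !mxE eqxx (ord1 j).
  - by move=> t; rewrite take0.
have [X [upX colX solX]] := IHm (ltnW lt_ms).
(* Overwrite the entry at the next position t; the equations listed before t
   do not involve it. *)
pose t := nth (ord0, ord0) s m; have ts : t \in s by rewrite mem_nth.
have idx_t : index t s = m by rewrite index_uniq.
have aX : a t X != 0 by apply: a_neq0 => //; rewrite idx_t.
have /andP[lt_t lt_tn] := range_s t ts.
pose Y : 'M[F]_n := \matrix_(i, j) if (i, j) == t then b t X / a t X else X i j.
have YE u : u != t -> Y u.1 u.2 = X u.1 u.2.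
  by case: u => i j /= /negPf nt; rewrite mxE nt.
have Yt : Y t.1 t.2 = b t X / a t X by rewrite mxE -surjective_pairing eqxx.
have upY : strictly_upper Y.
  move=> i j le_ji; rewrite (YE (i, j)) ?upX //.
  by apply: contraTneq lt_t => <- /=; rewrite -leqNgt.
have t_nmax : t.2 != ord_max by apply: contraTneq lt_tn => ->; rewrite ltnn.
have localY u : u \in take m.+1 s -> a u Y = a u X /\ b u Y = b u X.
  move=> us; have us' : u \in s := mem_take us.
  apply: (local_ab u us') => // w /orP[/eqP w_max|].
    by apply: YE; apply: contraNneq t_nmax => <-; rewrite w_max.
  move=> w_before; apply: YE; apply/eqP=> wt; move: w_before.
  rewrite wt in_take // idx_t; move: us; rewrite in_take //; lia.
exists Y; split=> //.
  apply/matrixP=> i j; rewrite -colX 2!mxE [in RHS]mxE; case: eqP => // it.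
  by move: t_nmax; rewrite -it eqxx.
move=> u us; have [-> ->] := localY u us.
have [->|u_nt] := eqVneq u t; first by rewrite Yt mulrC divfK.
rewrite YE //; apply: solX; move: us; rewrite (take_nth (ord0, ord0)) //.
by rewrite mem_rcons inE (negPf u_nt).
Qed.

Lemma triangular_system_unique (s : seq position)
    (a b : position -> 'M[F]_n -> F) X Y :
    (forall t : position, (t.1 < t.2 < n')%N -> t \in s) ->
    (forall t, t \in s -> forall X Y, strictly_upper X -> strictly_upper Y ->
       (forall u, obtained s t u -> X u.1 u.2 = Y u.1 u.2) ->
       a t X = a t Y /\ b t X = b t Y) ->
    (forall t, t \in s -> a t X != 0) ->
    strictly_upper X -> strictly_upper Y -> col ord_max X = col ord_max Y ->
    (forall t, t \in s -> a t X * X t.1 t.2 = b t X) ->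
    (forall t, t \in s -> a t Y * Y t.1 t.2 = b t Y) ->
  X = Y.
Proof.
move=> cover local_ab aX upX upY colXY solX solY.
have eq_max (u : position) : u.2 = ord_max -> X u.1 u.2 = Y u.1 u.2.
  by move=> ->; move/matrixP/(_ u.1 0): colXY; rewrite !mxE.
have eq_idx m : forall t, t \in s -> (index t s < m)%N -> X t.1 t.2 = Y t.1 t.2.
  elim: m => [//|m IHm] t ts lt_tm.
  have [aE bE] : a t X = a t Y /\ b t X = b t Y.
    apply: local_ab => // u /orP[/eqP/eq_max //|u_before].
    have us := mem_take u_before; apply: IHm => //.
    by move: u_before; rewrite in_take //; lia.
  by apply: (mulfI (aX t ts)); rewrite solX // aE bE solY.
apply/matrixP=> i j; have [le_ji|lt_ij] := leqP j i; first by rewrite upX ?upY.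
have [jmax|j_nmax] := eqVneq j ord_max; first exact: (eq_max (i, j)).
apply: (eq_idx (index (i, j) s).+1 (i, j)) => //; apply: cover => /=.
rewrite lt_ij /=; move: j_nmax (ltn_ord j); rewrite -val_eqE /=; lia.
Qed.

(** * The order of resolution *)

(** Positions are ordered by distance to the diagonal, then by decreasing row;
    the second summand stays below the weight [n] of the first. *)
Definition rank_pos (t : position) : nat := ((t.2 - t.1) * n + (n' - t.1))%N.

(** The strictly upper triangular positions outside the last column, by
    increasing [rank_pos]. *)
Definition schedule : seq position :=
  sort (relpre rank_pos leq) [seq t : position <- enum {: position} | (t.1 < t.2 < n')%N].

Lemma schedule_uniq : uniq schedule.
Proof. by rewrite sort_uniq filter_uniq ?enum_uniq. Qed.

Lemma mem_schedule t : (t \in schedule) = (t.1 < t.2 < n')%N.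
Proof. by rewrite mem_sort mem_filter mem_enum andbT. Qed.

Lemma schedule_before (t u : position) : u \in schedule ->
  (rank_pos u < rank_pos t)%N -> u \in take (index t schedule) schedule.
Proof.
move=> us lt_ut; rewrite in_take //; move: lt_ut; rewrite ltnNge; apply: contraR.
rewrite -leqNgt => le_tu.
have ts : t \in schedule by rewrite -index_mem (leq_ltn_trans le_tu) ?index_mem.
apply: (sorted_leq_index (leT := relpre rank_pos leq)) le_tu => //.
- by move=> x y z /=; apply: leq_trans.
- by move=> x /=.
- by apply: sort_sorted => x y; apply: leq_total.
Qed.

Lemma rank_pos_lt (t u : position) : (t.1 < t.2)%N -> (u.1 < u.2)%N ->
  (u.2 < u.1 + (t.2 - t.1) + (t.1 < u.1)%N)%N -> (rank_pos u < rank_pos t)%N.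
Proof.
case: t u => [i j] [c d]; rewrite /rank_pos /= => lt_ij lt_cd lt_d.
have lt_i := ltn_ord i; have lt_c := ltn_ord c.
have [lt_off|ge_off] := ltnP (d - c) (j - i).
  have := leq_mul lt_off (leqnn n); rewrite mulSn; lia.
have -> : (d - c = j - i)%N by move: lt_d; case: (i < c)%N; lia.
by move: lt_d; case: (ltnP i c) => ?; lia.
Qed.

(** The entries obtained before [t] include all those closer to the diagonal
    than [t], and those at the same distance on a lower row. *)
Lemma eq_obtained (t : position) X Y : t \in schedule ->
    strictly_upper X -> strictly_upper Y ->
    (forall u, obtained schedule t u -> X u.1 u.2 = Y u.1 u.2) ->
  forall i j : 'I_n, (j < i + (t.2 - t.1) + (t.1 < i)%N)%N -> X i j = Y i j.
Proof.
rewrite mem_schedule => /andP[lt_t lt_tn] upX upY eqXY i j lt_j.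
have [le_ji|lt_ij] := leqP j i; first by rewrite upX ?upY.
apply: (eqXY (i, j)); rewrite /obtained /=; case: (eqVneq j ord_max) => //= j_nmax.
apply: schedule_before; last exact: rank_pos_lt.
by rewrite mem_schedule /= lt_ij /=; move: j_nmax (ltn_ord j); rewrite -val_eqE /=; lia.
Qed.

Lemma pivot_local p g (t : position) X Y : t \in schedule ->
    strictly_upper X -> strictly_upper Y ->
    (forall u, obtained schedule t u -> X u.1 u.2 = Y u.1 u.2) ->
  pivot p g t X = pivot p g t Y /\ pivot_rhs p g t X = pivot_rhs p g t Y.
Proof.
move=> ts upX upY /(eq_obtained ts upX upY); move: ts.
case: t => i j; rewrite mem_schedule /= => /andP[lt_ij lt_jn] eqXY.
have i1 : (inord i.+1 : 'I_n) = i.+1 :> nat by rewrite inordK; lia.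
have j1 : (inord j.+1 : 'I_n) = j.+1 :> nat by rewrite inordK.
rewrite /pivot /pivot_rhs /=; split.
  by rewrite eqXY // j1 lt_ij; lia.
congr (_ + _ * _ + _); first by rewrite eqXY // i1 j1 ltnSn; lia.
  apply: eq_bigr => c nj.
  have [le_ci|lt_ic] := leqP c i; first by rewrite (upX i c) // (upY i c) // !mul0r.
  have [lt_jc|le_cj] := ltnP j c.
    by rewrite (upX c _) ?j1 // (upY c _) ?j1 // !mulr0.
  have lt_cj : (c < j)%N by rewrite ltn_neqAle le_cj andbT.
  by congr (_ * _); apply: eqXY; rewrite ?j1 ?lt_ic; lia.
apply: (@eq_higher_terms p g X Y (j - i)) => //; last by rewrite j1; lia.
by move=> c d lt_d; apply: eqXY; lia.
Qed.

(** * The first superdiagonal *)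

(** Neither conclusion presupposes the nonvanishing of the denominators: if
    [1 - (m+1) k y_0] were zero, then so would be [y_0], hence that denominator
    would be one. *)
Lemma fractional_chain (k : F) (y : nat -> F) m :
    (forall l, (l < m)%N -> y l.+1 * (1 - k * y l) = y l) ->
  1 - m%:R * k * y 0 != 0 /\ y m * (1 - m%:R * k * y 0) = y 0.
Proof.
elim: m => [|m IHm] chain; first by rewrite !mul0r subr0 mulr1 oner_neq0.
have [nz ym] := IHm (fun l lt_lm => chain l (ltnW lt_lm)).
have ymS : y m.+1 * (1 - m.+1%:R * k * y 0) = y 0.
  transitivity (y m.+1 * (1 - k * y m) * (1 - m%:R * k * y 0)); last by rewrite chain.
  by rewrite -(mulrA (y m.+1)) [(1 - k * _) * _]mulrBl -(mulrA k) ym -natr1; ring.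
split=> //; apply/eqP=> z; move: ymS; rewrite z mulr0 => y0.
by move: z; rewrite -y0 mulr0 subr0 => /eqP; rewrite oner_eq0.
Qed.

Lemma pivot_rhs_superdiag p g X (i j : 'I_n) : strictly_upper X ->
  j = i.+1 :> nat -> (j < n')%N -> pivot_rhs p g (i, j) X = X j (inord j.+1).
Proof.
move=> upX ji lt_jn; rewrite /pivot_rhs /= -ji inord_val.
have j1 : (inord j.+1 : 'I_n) = j.+1 :> nat by rewrite inordK.
rewrite big1 => [|c nj].
  rewrite mulr0 addr0 summxE big1 ?addr0 // => l _.
  by rewrite mxE expX_band ?mulr0 // j1; lia.
have [le_ci|lt_ic] := leqP c i; first by rewrite (upX i c) // mul0r.
rewrite (upX c) ?mulr0 // j1; move: nj; rewrite -val_eqE /=; lia.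
Qed.

(** The chain read off the first superdiagonal from the bottom row up, using
    only the scalar equations of its entries in columns [n' - m] to [n' - 1]. *)
Lemma superdiag_chain p g X m : strictly_upper X -> (m < n')%N ->
    (forall i j : 'I_n, j = i.+1 :> nat -> (n' <= j + m)%N -> (j < n')%N ->
       pivot p g (i, j) X * X i j = pivot_rhs p g (i, j) X) ->
  let c := 1 - m%:R * coef2 p g * X (inord n'.-1) ord_max in
  c != 0 /\ X (inord (n' - m.+1)) (inord (n' - m)) * c = X (inord n'.-1) ord_max.
Proof.
move=> upX lt_mn eqns.
pose y l := X (inord (n' - l.+1)) (inord (n' - l)).
have y0 : y 0 = X (inord n'.-1) ord_max.
  by rewrite /y subn0 subn1; congr (X _ _); apply: val_inj; rewrite /= inordK.
have chain l : (l < m)%N -> y l.+1 * (1 - coef2 p g * y l) = y l.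
  move=> lt_lm; have := eqns (inord (n' - l.+2)) (inord (n' - l.+1)).
  rewrite !inordK; try lia.
  have lS : ((n' - l.+1).+1 = n' - l)%N by lia.
  move=> /(_ ltac:(lia) ltac:(lia) ltac:(lia)).
  rewrite pivot_rhs_superdiag ?inordK //; try lia.
  rewrite /pivot /= inordK; last by lia.
  by rewrite lS mulrC.
by have := fractional_chain chain; rewrite y0.
Qed.

Lemma pivot_neq0 p g (t : position) X : t \in schedule -> strictly_upper X ->
    admissible n' p g (X (inord n'.-1) ord_max) ->
    (forall u, u \in take (index t schedule) schedule ->
       pivot p g u X * X u.1 u.2 = pivot_rhs p g u X) ->
  pivot p g t X != 0.
Proof.
case: t => i j ts upX adm eqns; have := ts; rewrite mem_schedule /= => /andP[lt_ij lt_jn].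
have [] := @superdiag_chain p g X (n' - j.+1) upX; first by lia.
  move=> c d dc le_d lt_dn; apply: (eqns (c, d)).
  apply: schedule_before; first by rewrite mem_schedule /= lt_dn; lia.
  by apply: rank_pos_lt => /=; lia.
have -> : (n' - (n' - j.+1).+1 = j)%N by lia.
have -> : (n' - (n' - j.+1) = j.+1)%N by lia.
rewrite inord_val /pivot /=; set x := X j _; set z := X _ _ in adm *.
move=> nz xz; apply/eqP => x0.
have /eqP[] : 1 - (n' - j)%:R * coef2 p g * z != 0 by apply: adm; lia.
have -> : (n' - j = (n' - j.+1).+1)%N by lia.
rewrite -natr1.
(* If the pivot were zero, the next denominator, which is its product with the
   current one, would be zero too. *)
have -> : 0 = (1 - coef2 p g * x) * (1 - (n' - j.+1)%:R * coef2 p g * z).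
  by rewrite x0 mul0r.
by rewrite [(1 - _ * x) * _]mulrBl -(mulrA _ x) xz; ring.
Qed.

(** On strictly upper triangular matrices, the matrix equation amounts to the
    scheduled scalar equations. *)
Lemma eqn_solved p g X : (2 <= p)%N -> strictly_upper X ->
    (forall t, t \in schedule -> pivot p g t X * X t.1 t.2 = pivot_rhs p g t X) <->
  eq_lhs X = eq_rhs p g X.
Proof.
move=> p_ge2 upX; split=> [sol|eqX t]; last first.
  rewrite mem_schedule => ts; apply/eqP; rewrite -subr_eq0 -eqn_affine //.
  by rewrite eqX subrr mxE.
apply/eqP; rewrite -subr_eq0; apply/eqP/matrixP=> i j; rewrite [RHS]mxE.
have [le_j|lt_j] := leqP j i.+1; first exact: eqn_below_band.
have lt_jn := ltn_ord j; pose k : 'I_n := inord j.-1.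
have kE : k = j.-1 :> nat by rewrite inordK //; lia.
have range_k : (i < k < n')%N by rewrite kE; lia.
have := @eqn_affine p g (i, k) X p_ge2 range_k.
rewrite sol ?mem_schedule // subrr /= kE prednK ?inord_val //; lia.
Qed.

Lemma nilpotent_solution_admissible p g X : (2 <= p)%N ->
    nilpotent_solution p g X ->
  admissible n' p g (X (inord n'.-1) ord_max).
Proof.
move=> p_ge2 solX i /andP[i_gt0 le_i].
have upX := nilpotent_solution_upper p_ge2 solX.
have [] := @superdiag_chain p g X i upX _ _ => //; first by lia.
move=> c d dc _ lt_dn; have [_ eqX] := solX.
by apply: ((eqn_solved g p_ge2 upX).2 eqX (c, d)); rewrite mem_schedule /= lt_dn; lia.
Qed.

(** * Existence and uniqueness for a given last column *)

Lemma solution_exists p g (v : 'cV[F]_n) : (2 <= p)%N ->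
    v ord_max 0 = 0 -> admissible n' p g (v (inord n'.-1) 0) ->
  exists X, nilpotent_solution p g X /\ col ord_max X = v.
Proof.
move=> p_ge2 v_max adm.
have nz t : t \in schedule -> forall X, strictly_upper X -> col ord_max X = v ->
    (forall u, u \in take (index t schedule) schedule ->
       pivot p g u X * X u.1 u.2 = pivot_rhs p g u X) -> pivot p g t X != 0.
  by move=> ts X upX colX; apply: pivot_neq0 => //; move: adm; rewrite -colX mxE.
have range_s t : t \in schedule -> (t.1 < t.2 < n')%N by rewrite mem_schedule.
have [X [upX colX solX]] := triangular_system_exists schedule_uniq range_s
  (fun t ts X Y => @pivot_local p g t X Y ts) nz v_max.
exists X; split=> //; split; first exact: strictly_upper_nilpotent.
by apply/eqn_solved.
Qed.

Lemma solution_unique p g X Y : (2 <= p)%N ->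
    nilpotent_solution p g X -> nilpotent_solution p g Y ->
    col ord_max X = col ord_max Y ->
  X = Y.
Proof.
move=> p_ge2 solX solY colXY.
have upX := nilpotent_solution_upper p_ge2 solX.
have upY := nilpotent_solution_upper p_ge2 solY.
have eqnX := (eqn_solved g p_ge2 upX).2 solX.2.
have eqnY := (eqn_solved g p_ge2 upY).2 solY.2.
have adm := nilpotent_solution_admissible p_ge2 solX.
have cover (t : position) : (t.1 < t.2 < n')%N -> t \in schedule.
  by rewrite mem_schedule.
have nz t : t \in schedule -> pivot p g t X != 0.
  by move=> ts; apply: pivot_neq0 => // u /mem_take; apply: eqnX.
exact: (triangular_system_unique cover
  (fun t ts X Y => @pivot_local p g t X Y ts) nz upX upY colXY eqnX eqnY).
Qed.

Lemma schedule_solves p g : (2 <= p)%N -> recursively_solvable n' p g.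
Proof.
move=> p_ge2; exists schedule, eqn_pos, (pivot p g), (pivot_rhs p g); split.
- exact: schedule_uniq.
- exact: mem_schedule.
- move=> t ts; split=> [X Y|X upX|X].
  + exact: pivot_local.
  + by apply: eqn_affine; rewrite -?mem_schedule.
  + exact: pivot_neq0.
Qed.

End NilpotentSolutions.

Theorem theorem4 (R : realType) (n' p : nat) (g : {poly R[i]}) :
  (3 <= n'.+1)%N -> (2 <= p <= n'.+1 - 1)%N ->
  g.[0] != 0 -> ((size g).-1 < n'.+1 - p)%N ->
  [/\ forall X : 'M[R[i]]_n'.+1, nilpotent_solution p g X ->
        strictly_upper X /\ admissible n' p g (X (inord n'.-1) ord_max),
      forall v : 'cV[R[i]]_n'.+1, v ord_max 0 = 0 ->
        admissible n' p g (v (inord n'.-1) 0) ->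
        exists! X : 'M[R[i]]_n'.+1,
          nilpotent_solution p g X /\ col ord_max X = v
    & recursively_solvable n' p g].
Proof.
move=> _ /andP[p_ge2 _] _ _; split.
- move=> X solX; split; first exact: nilpotent_solution_upper p_ge2 solX.
  exact: nilpotent_solution_admissible p_ge2 solX.
- move=> v v_max adm.
  have [X [solX colX]] := solution_exists p_ge2 v_max adm.
  exists X; split=> // Y [solY colY].
  by apply: solution_unique p_ge2 solX solY _; rewrite colX colY.
- exact: schedule_solves.
Qed.
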